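(* Let $A$ be a set and let $\Gamma$ be a countable (finite or countably infinite) set of unary relations on $A$ (i.e. subsets of $A$) containing some $\gamma\in\Gamma$ with $\emptyset\neq\gamma\subsetneq A$. Then $$\bigl|\{\operatorname{Pol}_A Q \mid Q\subseteq \mathrm{DD}(\Gamma),\ Q \text{ finite}\}\bigr| = \aleph_0 .$$
   Context: An $n$-ary relation on $A$ is a subset of $A^n$; an $n$-ary operation on $A$ is a map $A^n\to A$. Let $\mathrm{O}_A$ be the set of all operations on $A$ of arity $n\geq 1$. An $n$-ary operation $f$ preserves an $m$-ary relation $\rho\subseteq A^m$ (written $f\rhd\rho$) if for all $r_1,\dots,r_n\in\rho$ the $m$-tuple obtained by applying $f$ coordinatewise to $r_1,\dots,r_n$ is in $\rho$. For a set $Q$ of finitary relations on $A$ (of positive arity), $\operatorname{Pol}_A Q=\{f\in \mathrm{O}_A\mid f\rhd\rho \text{ for all }\rho\in Q\}$. For $n\geq 1$ and $\gamma_1,\dots,\gamma_n\subseteq A$ put $\mathrm{R}(\gamma_1,\dots,\gamma_n)=\{(x_1,\dots,x_n)\in A^n\mid x_1\in\gamma_1\text{ or }\dots\text{ or }x_n\in\gamma_n\}$. For a set $\Gamma$ of unary relations on $A$, $\mathrm{DD}(\Gamma)$ is the set of all relations $\mathrm{R}(\gamma_1,\dots,\gamma_n)$ with $n\geq 1$ and $(\gamma_1,\dots,\gamma_n)\in\Gamma^n$. *)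

(* Defs.v *)
From mathcomp Require Import all_boot.
From mathcomp Require Import boolp classical_sets functions cardinality.

Set Implicit Arguments.
Unset Strict Implicit.
Unset Printing Implicit Defensive.

Local Open Scope classical_set_scope.

(* Arities are positive: the index n stands for the arity n.+1, and A^n.+1 is
   the type of functions 'I_n.+1 -> A. *)
Definition power (A : Type) (n : nat) : Type := 'I_n.+1 -> A.

Definition operation (A : Type) : Type := {n : nat & power A n -> A}.

Definition relation (A : Type) : Type := {m : nat & set (power A m)}.

Definition preserves (A : Type) (f : operation A) (rho : relation A) : Prop :=
  forall r : 'I_(projT1 f).+1 -> power A (projT1 rho),
    (forall i, projT2 rho (r i)) ->
    projT2 rho (fun j => projT2 f (fun i => r i j)).

Definition Pol (A : Type) (Q : set (relation A)) : set (operation A) :=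
  [set f | forall rho, Q rho -> preserves f rho].

Definition disj_rel (A : Type) (n : nat) (gamma : 'I_n.+1 -> set A) :
    relation A :=
  existT (fun m => set (power A m)) n [set x | exists i, gamma i (x i)].

Definition DD (A : Type) (Gamma : set (set A)) : set (relation A) :=
  [set rho | exists (n : nat) (gamma : 'I_n.+1 -> set A),
     (forall i, Gamma (gamma i)) /\ rho = disj_rel gamma].

(* Main.v *)
(** The upper bound is a count of finite subsets of the countable set
    [DD Gamma].  For the lower bound, fix [a] in [gamma], [b] outside, and let
    [g_j] be the operation of arity [j+1] returning [a] if at least two of its
    arguments lie in [gamma], and [b] otherwise.  The [j+1] unit rows ([a] on the
    diagonal, [b] elsewhere) show that [g_j] does not preserve
    [R(gamma, ..., gamma)] of arity [j+1].  In smaller arity, each of [j+1] rows of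
    the relation has an entry in [gamma], so by pigeonhole some column has two, and
    [g_j] preserves the relation. *)
Require Import Defs.
From mathcomp Require Import all_boot.
From mathcomp Require Import boolp classical_sets functions cardinality.

Local Open Scope classical_set_scope.

Lemma countable_sub_range (T : countType) (U : Type) (f : T -> U) (B : set U) :
  B `<=` range f -> countable B.
Proof.
move=> sBf; apply: (@sub_countable _ _ B [set: T]); last exact: countableP.
exact: card_le_trans (subset_card_le sBf) (card_image_le f _).
Qed.

(** An injective coding of [D] by naturals lets a finite [Q] be recovered from a list of its codes,
    and [seq nat] is a countable type. *)
Lemma countable_finite_subsets (T : Type) (D : set T) :
  countable D -> countable [set Q | Q `<=` D /\ finite_set Q].
Proof.
move=> /countable_injP[f f_inj].
pose decode (s : seq nat) := [set x | D x /\ f x \in s].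
apply: (@countable_sub_range _ _ decode) => Q [QD Qfin].
have [s fQ] := (finite_seqP _).1 (finite_image f Qfin).
have fQP k : (k \in s) <-> (f @` Q) k by rewrite fQ.
exists s => //; apply/seteqP; split=> [x [Dx /fQP[y Qy fyx]]|x Qx].
  by rewrite -(f_inj y x) // inE //; exact: QD.
by split; [exact: QD | apply/fQP; exists x].
Qed.

Lemma countable_DD (A : Type) (Gamma : set (set A)) :
  countable Gamma -> countable (DD Gamma).
Proof.
move=> /countable_injP[f f_inj].
(* As a union over the members of [Gamma] with code [k], [e] inverts [f] on [Gamma] without choosing
   a preimage. *)
pose e k := [set x | exists g, [/\ Gamma g, f g = k & g x]].
have eK g : Gamma g -> e (f g) = g.
  move=> Gg; apply/seteqP; split=> [x [h [Gh fhg hx]]|x gx]; last by exists g.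
  by rewrite -(f_inj h g) // inE.
pose decode (c : {n : nat & {ffun 'I_n.+1 -> nat}}) :=
  disj_rel (fun i => e (projT2 c i)).
apply: (@countable_sub_range _ _ decode) => _ [n [gamma [Ggamma ->]]].
exists (existT _ n [ffun i => f (gamma i)]) => //.
by congr disj_rel; apply: funext => i; rewrite /= ffunE eK.
Qed.

Section Threshold.
Variables (A : Type) (gamma : set A) (a b : A).
Hypotheses (gamma_a : gamma a) (gammaN_b : ~ gamma b).

Definition threshold (j : nat) : operation A :=
  existT (fun n => power A n -> A) j (fun x =>
    if `[< exists i k, [/\ i <> k, gamma (x i) & gamma (x k)] >] then a else b).

Lemma threshold_preserves (i j : nat) : i < j ->
  preserves (threshold j) (disj_rel (fun _ : 'I_i.+1 => gamma)).
Proof.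
move=> ltij r /= r_gamma.
have [c cP] := choice r_gamma.
have /injectivePn[k [l neq_kl eq_c]] : ~~ injectiveb c.
  apply/negP => /injectiveP /leq_card; rewrite !card_ord ltnS.
  by rewrite leqNgt ltij.
exists (c k); rewrite asboolT //; exists k, l; split=> //.
- by apply/eqP.
- by rewrite eq_c.
Qed.

Lemma threshold_not_preserves (j : nat) :
  ~ preserves (threshold j) (disj_rel (fun _ : 'I_j.+1 => gamma)).
Proof.
move=> /(_ (fun i k => if i == k then a else b)) /= [i|k].
  by exists i; rewrite eqxx.
(* Column [k] meets [gamma] only in row [k], so distinct rows [i] and [l] cannot both do so. *)
case: asboolP => // -[i [l [neq_il]]].
by case: eqP => // <-; case: eqP => // eq_li; case: neq_il.
Qed.

End Threshold.

Theorem corollary25 (A : Type) (Gamma : set (set A))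
  (Gamma_countable : countable Gamma)
  (Gamma_nontrivial : exists gamma : set A,
     [/\ Gamma gamma, gamma !=set0 & gamma `<` [set: A]]) :
  ([set F : set (operation A) |
     exists Q : set (relation A), [/\ Q `<=` DD Gamma, finite_set Q & F = Pol Q]]
  #= [set: nat])%card.
Proof.
apply: Cantor_Bernstein.
  pose S := [set Q | Q `<=` DD Gamma /\ finite_set Q].
  apply: (@sub_countable _ _ _ S);
    last exact/countable_finite_subsets/countable_DD.
  apply: card_le_trans (card_image_le (@Pol A) S).
  by apply: subset_card_le => _ [Q [QD Qfin ->]]; exists Q.
have [gamma [Ggamma [a gamma_a] [_ /existsNP[b /not_implyP[_ gammaN_b]]]]] := Gamma_nontrivial.
pose R n := disj_rel (fun _ : 'I_n.+1 => gamma).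
have Pol_neq i j : i < j -> Pol [set R i] <> Pol [set R j].
  (* The threshold operation of index [j] separates the two clones: it preserves [R i] but not
     [R j]. *)
  move=> ltij eqP; apply: (@threshold_not_preserves _ _ _ _ gamma_a gammaN_b j).
  suff : Pol [set R j] (threshold _ gamma a b j) by apply.
  rewrite -eqP => _ ->; exact: threshold_preserves.
have Pol_inj : injective (fun n => Pol [set R n]).
  by move=> i j eqP; case: (ltngtP i j) => // /Pol_neq[].
have /card_eqPle[_ le_range] :=
  inj_card_eq (in2W Pol_inj : {in [set: nat] &, injective _}).
apply: card_le_trans le_range _; apply: subset_card_le => _ [n _ <-].
exists [set R n]; split=> //.
by move=> _ ->; exists n, (fun=> gamma).
Qed.
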